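(* Let $d\geq 1$ and let $\mathcal{F}=\{C_0,\ldots,C_d\}$ be a $d$-critical family in $\mathbb{R}^d$. Then one of the connected components of $\mathbb{R}^d\setminus\bigcup_{i=0}^d C_i$ is a non-empty bounded region $D$, and the closure of $\mathrm{Conv}(D)$ is a $d$-simplex.
   Context: A family of compact convex sets $C_0,C_1,\ldots,C_n\subset\mathbb{R}^d$ is called an $n$-critical family if $\bigcap_{i\neq j}C_i\neq\varnothing$ for every $j=0,1,\ldots,n$ (the intersection being over $i\in\{0,\ldots,n\}$, $i\neq j$), but $\bigcap_{i=0}^n C_i=\varnothing$. Here this is used with $n=d$. $\mathrm{Conv}(X)$ denotes the convex hull of $X\subset\mathbb{R}^d$. A $d$-simplex is the convex hull of $d+1$ affinely independent points. *)

(* Defs.v *)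
From HB Require Import structures.
From mathcomp Require Import all_boot all_order all_algebra.
From mathcomp Require Import all_classical all_reals all_analysis.

Set Implicit Arguments.
Unset Strict Implicit.
Unset Printing Implicit Defensive.

Import Order.TTheory GRing.Theory Num.Theory.
Import numFieldNormedType.Exports.

Local Open Scope classical_set_scope.
Local Open Scope ring_scope.

(* R^d is ['rV[R]_d]; its library norm is the sup norm, which yields the usual
   topology and bounded sets. *)

Definition critical_family (R : realType) (d n : nat)
    (C : 'I_n.+1 -> set 'rV[R]_d) : Prop :=
  [/\ forall i, compact (C i),
      forall i, convex_set (C i),
      forall j, \bigcap_(i in [set i | i != j]) C i !=set0 &
      \bigcap_i C i = set0].

Definition convex_hull (R : realType) (d : nat) (X : set 'rV[R]_d) :
    set 'rV[R]_d :=
  smallest (fun A : set 'rV[R]_d => convex_set A) X.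

Definition affinely_independent (R : realType) (d k : nat)
    (v : 'I_k -> 'rV[R]_d) : Prop :=
  forall a : 'I_k -> R,
    \sum_i a i = 0 -> \sum_i a i *: v i = 0 -> forall i, a i = 0.

Definition is_simplex (R : realType) (d k : nat) (S : set 'rV[R]_d) : Prop :=
  exists2 v : 'I_k.+1 -> 'rV[R]_d,
    affinely_independent v & S = convex_hull (range v).

(* [connected_component A x] is empty when x is not in A, hence the condition
   [A x]. *)
Definition is_component (T : topologicalType) (A D : set T) : Prop :=
  exists2 x, A x & D = connected_component A x.

(* Main.v *)
(* Let [g_i x] be [x] minus its nearest point in [C_i].  For positive weights
   [w] there is exactly one [x] with [\sum_i w_i g_i x = 0], the minimizer of
   [\sum_i w_i dist(x, C_i)^2], and it lies outside every [C_i]: otherwise pair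
   this sum with [q - x], where [q] is a point common to the sets other than
   one that contains [x].

   Let [K_j] be the intersection of the [C_i], [i != j], and pick [p_j] in
   [K_j].  At the minimizer [x] the matrix [<g_i x, p_j - x>] is negative off
   the diagonal and is annihilated on the left by [w].  A Perron-Frobenius
   argument shows that the [p_j] are affinely independent and that [x] is
   interior to their simplex.  The facet opposite [p_j] lies in [C_j], so the
   component [D] of the complement that contains [x] stays inside the simplex.

   Letting the weight of [C_j] decrease from 1 to 0 moves the minimizer
   continuously inside [D] towards [K_j].  Thus the closure of [D] contains a
   point [q_j] of each [K_j], and the closed convex hull of [D] is the simplex
   with vertices [q_j]. *)

Require Import Defs.
From HB Require Import structures.
From mathcomp Require Import all_boot all_order all_algebra.
From mathcomp Require Import all_classical all_reals all_analysis.
From mathcomp Require Import ring lra.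

Set Implicit Arguments.
Unset Strict Implicit.
Unset Printing Implicit Defensive.

Import Order.TTheory GRing.Theory Num.Theory.
Import numFieldNormedType.Exports.

Local Open Scope classical_set_scope.
Local Open Scope ring_scope.

(** * Euclidean inner product on row vectors, compared with the sup norm *)

Section DotProduct.
Context {R : realType} {d : nat}.
Implicit Types (x y u v : 'rV[R]_d) (a : R).

(** Nearest points need the Euclidean norm, while the norm of ['rV[R]_d] is the sup norm; Euclidean
    lengths therefore enter as [dot u u]. *)
Definition dot u v : R := \sum_k u 0 k * v 0 k.

Lemma dotC u v : dot u v = dot v u.
Proof. by apply: eq_bigr => k _; rewrite mulrC. Qed.

Lemma dotDl u v x : dot (u + v) x = dot u x + dot v x.
Proof. by rewrite -big_split; apply: eq_bigr => k _; rewrite mxE mulrDl. Qed.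

Lemma dotZl a u v : dot (a *: u) v = a * dot u v.
Proof. by rewrite mulr_sumr; apply: eq_bigr => k _; rewrite mxE mulrA. Qed.

Lemma dotNl u v : dot (- u) v = - dot u v.
Proof. by rewrite -scaleN1r dotZl mulN1r. Qed.

Lemma dotBl u v x : dot (u - v) x = dot u x - dot v x.
Proof. by rewrite dotDl dotNl. Qed.

Lemma dotDr u v x : dot x (u + v) = dot x u + dot x v.
Proof. by rewrite dotC dotDl !(dotC x). Qed.

Lemma dotZr a u v : dot v (a *: u) = a * dot v u.
Proof. by rewrite dotC dotZl dotC. Qed.

Lemma dotNr u v : dot v (- u) = - dot v u.
Proof. by rewrite dotC dotNl dotC. Qed.

Lemma dotBr u v x : dot x (u - v) = dot x u - dot x v.
Proof. by rewrite dotDr dotNr. Qed.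

Lemma dot0l u : dot 0 u = 0.
Proof. by rewrite -(scale0r 0) dotZl mul0r. Qed.

Lemma dot0r u : dot u 0 = 0.
Proof. by rewrite dotC dot0l. Qed.

Lemma dot_suml (I : Type) (r : seq I) (P : pred I) (F : I -> 'rV[R]_d) v :
  dot (\sum_(i <- r | P i) F i) v = \sum_(i <- r | P i) dot (F i) v.
Proof.
elim/big_rec2: _ => [|i y1 y2 _ <-]; first by rewrite dot0l.
by rewrite dotDl.
Qed.

Lemma dot_sumr (I : Type) (r : seq I) (P : pred I) (F : I -> 'rV[R]_d) v :
  dot v (\sum_(i <- r | P i) F i) = \sum_(i <- r | P i) dot v (F i).
Proof. by rewrite dotC dot_suml; apply: eq_bigr => i _; rewrite dotC. Qed.

Lemma dot_ge0 u : 0 <= dot u u.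
Proof. by apply: sumr_ge0 => k _; rewrite -expr2 sqr_ge0. Qed.

Lemma dot_eq0 u : dot u u = 0 -> u = 0.
Proof.
move=> /eqP; rewrite psumr_eq0 => [/allP u0|k _]; last first.
  by rewrite -expr2 sqr_ge0.
apply/rowP => k; rewrite mxE.
by have := u0 k (mem_index_enum _); rewrite /= mulf_eq0 orbb => /eqP.
Qed.

Lemma dot_gt0 u : u != 0 -> 0 < dot u u.
Proof.
by move=> u0; rewrite lt0r dot_ge0 andbT; apply: contra u0 => /eqP/dot_eq0/eqP.
Qed.

Lemma continuous_dot (T : topologicalType) (f g : T -> 'rV[R]_d) :
  continuous f -> continuous g -> continuous (fun t => dot (f t) (g t)).
Proof.
move=> cf cg; apply: continuous_big => [|k _]; first exact: add_continuous.
have cc (h : T -> 'rV[R]_d) : continuous h -> continuous (fun t => h t 0 k).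
  move=> ch t; apply: (@continuous_comp _ _ _ h (fun M : 'rV[R]_d => M 0 k)).
    exact: ch.
  exact: coord_continuous.
by move=> t; apply: continuousM; [exact: cc cf t|exact: cc cg t].
Qed.

Lemma normr_rV_le (e : R) u :
  0 <= e -> (`|u| <= e) <-> forall k, `|u 0 k| <= e.
Proof.
move=> e0; rewrite [`|u|]/Num.norm/= mx_normrE; split=> [ue k|ue].
  exact: le_trans (le_bigmax _ (fun ij : 'I_1 * 'I_d => `|u ij.1 ij.2|) (0, k)) ue.
by apply/bigmax_leP; split=> // -[i k] _ /=; rewrite ord1.
Qed.

Lemma sqr_coord_le_dot u k : `|u 0 k| ^+ 2 <= dot u u.
Proof.
rewrite /dot (bigD1 k) //= real_normK ?num_real// expr2 lerDl.
by apply: sumr_ge0 => l _; rewrite -expr2 sqr_ge0.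
Qed.

Lemma dot_le_sqr_norm u : dot u u <= d%:R * `|u| ^+ 2.
Proof.
rewrite -[d in d%:R]card_ord -sum1_card natr_sum mulr_suml.
apply: ler_sum => k _; rewrite mul1r -expr2 -real_normK ?num_real//.
by rewrite lerXn2r ?nnegrE//; exact: (normr_rV_le u (normr_ge0 u)).1.
Qed.

(** The two norms are comparable: the Euclidean length bounds each coordinate and is at most
    [sqrt d] times the sup norm. *)
Lemma dot_nonexpansive_continuous (f : 'rV[R]_d -> 'rV[R]_d) :
  (forall x y, dot (f x - f y) (f x - f y) <= dot (x - y) (x - y)) ->
  continuous f.
Proof.
move=> fne x; apply/(@cvgrPdist_le _ 'rV[R]_d _ (nbhs x)) => e e0.
near=> y.
apply: (normr_rV_le _ (ltW e0)).2 => k.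
rewrite -(@ler_pXn2r _ 2) ?nnegrE ?(ltW e0)//.
apply: le_trans (sqr_coord_le_dot _ _) _.
apply: le_trans (fne _ _) _.
apply: le_trans (dot_le_sqr_norm _) _.
(* [d.+1] is positive even for [d = 0], and [d <= d.+1 ^ 2] absorbs the factor [d]. *)
have d1 : 0 < d.+1%:R :> R by rewrite ltr0n.
have xy : `|x - y| <= e / d.+1%:R.
  near: y; apply: cvgr_dist_le => //; exact: divr_gt0.
apply: (@le_trans _ _ (d%:R * (e / d.+1%:R) ^+ 2)).
  rewrite ler_wpM2l// lerXn2r ?nnegrE//.
  exact: le_trans (normr_ge0 (x - y)) xy.
rewrite exprMn mulrCA ger_pMr ?exprn_gt0// exprVn ler_pdivrMr ?exprn_gt0// mul1r.
by rewrite -natrX ler_nat (leq_trans (leqnSn d))// -{1}(expn1 d.+1) leq_pexp2l.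
Unshelve. all: by end_near. Qed.

End DotProduct.

(** * Convex sets and finite convex combinations *)

Section Convexity.
Context {R : realType} {d : nat}.
Implicit Types (A : set 'rV[R]_d) (x y : 'rV[R]_d).

(** The library quantifies over scalars of an interval type; real scalars with explicit bounds are
    easier to apply. *)
Lemma convex_setP A : convex_set A <->
  forall x y (t : R), 0 <= t -> t <= 1 -> A x -> A y ->
    A (t *: x + (1 - t) *: y).
Proof.
split=> [cA x y t t0 t1 Ax Ay|cA x y t /set_mem Ax /set_mem Ay]; last first.
  by apply/mem_set/cA.
have t01 : Itv.spec (Itv.num_sem (R:=R)) (Itv.Real `[0%Z, 1%Z]) t.
  by rewrite /Itv.spec /Itv.num_sem /= num_real in_itv /= t0 t1.
have /= := cA x y (Itv.Def t01) (mem_set Ax) (mem_set Ay).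
by move/set_mem.
Qed.

(** Membership is asked only where the coefficient is nonzero, so that a point of a facet can be
    placed in a set containing just the vertices of that facet. Induction: split off the first point
    and renormalise the rest by their total weight [s]. *)
Lemma convex_sum A (k : nat) (a : 'I_k -> R) (v : 'I_k -> 'rV[R]_d) :
  convex_set A -> (forall i, 0 <= a i) -> \sum_i a i = 1 ->
  (forall i, a i != 0 -> A (v i)) -> A (\sum_i a i *: v i).
Proof.
move=> /convex_setP cA; elim: k a v => [|k IH] a v a0 a1 Av.
  by move: a1; rewrite big_ord0 => /eqP; rewrite eq_sym oner_eq0.
rewrite big_ord_recl; move: a1; rewrite big_ord_recl => a1.
set s := \sum_(i < k) a (lift ord0 i) in a1.
have s0 : 0 <= s by exact: sumr_ge0.
have [s_eq0|sn0] := eqVneq s 0.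
  have z i : a (lift ord0 i) = 0.
    by move/eqP: s_eq0; rewrite psumr_eq0// => /allP/(_ i (mem_index_enum _))/eqP.
  rewrite big1 => [|i _]; last by rewrite z scale0r.
  have a01 : a ord0 = 1 by rewrite -a1 s_eq0 addr0.
  by rewrite a01 scale1r addr0; apply: Av; rewrite a01 oner_neq0.
have rest : A (\sum_(i < k) (a (lift ord0 i) / s) *: v (lift ord0 i)).
  apply: IH => [i||i ai].
  - by rewrite divr_ge0.
  - by rewrite -mulr_suml divff.
  - by apply: Av; apply: contra ai => /eqP->; rewrite mul0r.
have -> : \sum_(i < k) a (lift ord0 i) *: v (lift ord0 i) =
    s *: \sum_(i < k) (a (lift ord0 i) / s) *: v (lift ord0 i).
  rewrite scaler_sumr; apply: eq_bigr => i _.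
  by rewrite scalerA mulrCA divff// mulr1.
move: (\sum_(i < k) _ *: _) rest => w Aw.
have [a00|a00] := eqVneq (a ord0) 0.
  have -> : s = 1 by rewrite -a1 a00 add0r.
  by rewrite a00 scale0r add0r scale1r.
have -> : s = 1 - a ord0 by rewrite -a1 addrAC subrr add0r.
by apply: cA => //; [rewrite -a1 lerDl|exact: Av].
Qed.

End Convexity.

Lemma continuous_sub (R : realType) (T : topologicalType) (V : normedModType R)
    (f g : T -> V) :
  continuous f -> continuous g -> continuous (fun t => f t - g t).
Proof. by move=> cf cg t; apply: cvgB; [exact: cf|exact: cg]. Qed.

Lemma continuous_mull (R : realType) (T : topologicalType) (c : R) (f : T -> R) :
  continuous f -> continuous (fun t => c * f t).
Proof. by move=> cf t; apply: cvgMl_tmp; exact: cf. Qed.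

Lemma continuous_scale (R : realType) (T : topologicalType)
    (V : normedModType R) (c : T -> R) (f : T -> V) :
  continuous c -> continuous f -> continuous (fun t => c t *: f t).
Proof. by move=> cc cf t; apply: cvgZ; [exact: cc|exact: cf]. Qed.

(* The default value [x] is only taken when no nearest point exists. *)
Definition proj (R : realType) (d : nat) (A : set 'rV[R]_d) (x : 'rV[R]_d) :=
  xget x [set y | A y /\
    forall z, A z -> dot (x - y) (x - y) <= dot (x - z) (x - z)].

Definition gap (R : realType) (d : nat) (A : set 'rV[R]_d) (x : 'rV[R]_d) :=
  x - proj A x.

(** * Nearest-point projection onto a compact convex set *)

Section Projection.
Context {R : realType} {d : nat}.
Variable A : set 'rV[R]_d.
Hypotheses (cptA : compact A) (cvxA : convex_set A) (A0 : A !=set0).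
Implicit Types (x y z : 'rV[R]_d).

Lemma proj_nearest x : A (proj A x) /\
  forall z, A z -> dot (x - proj A x) (x - proj A x) <= dot (x - z) (x - z).
Proof.
have cf : continuous (fun z => dot (x - z) (x - z)).
  have cx : continuous (fun z => x - z).
    by apply: continuous_sub => z; [exact: cst_continuous|exact: cvg_id].
  exact: continuous_dot.
have [y /set_mem Ay ymin] := EVT_min_rV A0 cptA (continuous_subspaceT cf).
rewrite /proj; case: xgetP => [//|/(_ y)[]]; split=> // z Az.
exact/ymin/mem_set.
Qed.

Lemma proj_in x : A (proj A x).
Proof. exact: (proj_nearest x).1. Qed.

(** Variational inequality: a positive value would allow a move from the nearest point towards [z]
    that gets closer to [x]. *)
Lemma dot_gap_proj x z : A z -> dot (gap A x) (z - proj A x) <= 0.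
Proof.
move=> Az; rewrite leNgt; apply/negP => a0.
set a := dot _ _ in a0.
set b := dot (z - proj A x) (z - proj A x).
have b0 : 0 <= b by exact: dot_ge0.
have ab0 : 0 < a + b by rewrite ltr_wpDr.
(* With [t * (a + b) = a], the squared distance drops by [t * a + t ^ 2 * a]. *)
pose t := a / (a + b).
have t0 : 0 < t by exact: divr_gt0.
have t1 : t <= 1 by rewrite ler_pdivrMr// mul1r lerDl.
have := (proj_nearest x).2 _
  ((convex_setP A).1 cvxA _ _ t (ltW t0) t1 Az (proj_in x)).
have -> : x - (t *: z + (1 - t) *: proj A x) =
    gap A x - t *: (z - proj A x).
  by rewrite /gap; apply/rowP => k; rewrite !mxE; ring.
have tb : t * (a + b) = a by rewrite divfK// gt_eqF.
rewrite -/(gap A x); move: a0 t0 tb; rewrite /a /b {t1}.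
move: (gap A x) (z - proj A x) t => g u t a0 t0 tb.
rewrite dotBl !dotBr !dotZl !dotZr (dotC u g).
have := congr1 ( *%R t) tb; rewrite mulrDr.
have := mulr_gt0 t0 a0; have := mulr_gt0 t0 (mulr_gt0 t0 a0); lra.
Qed.

(** Sum of the variational inequalities at [x] and at [y], each tested against the other
    projection. *)
Lemma gap_proj_monotone x y :
  0 <= dot (gap A x - gap A y) (proj A x - proj A y).
Proof.
have h1 := dot_gap_proj x (proj_in y).
have h2 := dot_gap_proj y (proj_in x).
rewrite dotBl subr_ge0 (le_trans h2)//.
by rewrite -(opprB (proj A y)) dotNr oppr_ge0.
Qed.

(** Expand the square of [x - y], the sum of the differences of gaps and of projections: the cross
    term is nonnegative by monotonicity. *)
Lemma proj_nonexpansive x y :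
  dot (proj A x - proj A y) (proj A x - proj A y) <= dot (x - y) (x - y).
Proof.
have := dot_ge0 (gap A x - gap A y).
have -> : x - y = (gap A x - gap A y) + (proj A x - proj A y).
  by rewrite /gap; apply/rowP => k; rewrite !mxE; ring.
have := gap_proj_monotone x y.
move: (gap A x - _) (proj A x - _) => g u.
by rewrite dotDl !dotDr (dotC u); lra.
Qed.

Lemma proj_continuous : continuous (proj A).
Proof. exact: dot_nonexpansive_continuous proj_nonexpansive. Qed.

Lemma gap_continuous : continuous (gap A).
Proof. by apply: continuous_sub => [x|]; [exact: cvg_id|exact: proj_continuous]. Qed.

Lemma gap_eq0 x : gap A x = 0 <-> A x.
Proof.
split=> [/eqP|Ax]; first by rewrite subr_eq0 => /eqP->; exact: proj_in.
apply: dot_eq0; apply/eqP; rewrite eq_le dot_ge0 andbT.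
exact: dot_gap_proj Ax.
Qed.

(** The variational inequality seen from [x] instead of its projection; it later makes the
    off-diagonal matrix entries negative. *)
Lemma dot_gap_le x z : A z -> dot (gap A x) (z - x) <= - dot (gap A x) (gap A x).
Proof.
move=> /(dot_gap_proj x).
have -> : z - x = (z - proj A x) - gap A x.
  by rewrite /gap; apply/rowP => k; rewrite !mxE; ring.
by move: (gap A x) (z - proj A x) => g u; rewrite dotBr; lra.
Qed.

(** Firm nonexpansiveness, from the same decomposition of [x - y]; it drives the uniqueness of
    equilibria. *)
Lemma gap_firm x y :
  dot (gap A x - gap A y) (gap A x - gap A y) <=
  dot (gap A x - gap A y) (x - y).
Proof.
have -> : x - y = (gap A x - gap A y) + (proj A x - proj A y).
  by rewrite /gap; apply/rowP => k; rewrite !mxE; ring.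
have := gap_proj_monotone x y.
by move: (gap A x - _) (proj A x - _) => g u; rewrite dotDr lerDl.
Qed.

(** With equal gaps the projections differ by [y - x], and the variational inequalities at [x] and
    [y] bound the same product from both sides. *)
Lemma gap_eq_orth x y : gap A x = gap A y -> dot (gap A x) (y - x) = 0.
Proof.
move=> gxy.
have h1 := dot_gap_proj x (proj_in y).
have h2 := dot_gap_proj y (proj_in x).
have yx : proj A y - proj A x = y - x.
  by move: gxy; rewrite /gap => /rowP gxy; apply/rowP => k;
    have := gxy k; rewrite !mxE; lra.
by move: h1 h2; rewrite -gxy -(opprB (proj A y)) dotNr yx; lra.
Qed.

End Projection.

(** * Matrices with negative off-diagonal entries and a positive left kernel vector *)

Section SignPattern.
Context {R : realType}.

(** [A] has the shape of a singular irreducible M-matrix; this is the Perron-Frobenius property that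
    its nonzero right kernel vectors have one strict sign. *)
Lemma kernel_neg_offdiag_gt0 (n : nat) (A : 'I_n -> 'I_n -> R)
    (w a : 'I_n -> R) :
  (forall i j, i != j -> A i j < 0) -> (forall i, 0 < w i) ->
  (forall j, \sum_i w i * A i j = 0) -> (forall i, \sum_j a j * A i j = 0) ->
  (exists k, 0 < a k) -> forall l, 0 < a l.
Proof.
move=> Aneg w0 wA Aa [k ak] l; rewrite ltNge; apply/negP => al.
(* Sum only the rows where [a] is positive: then every [a j * c j] is nonnegative,
   while their total vanishes. *)
pose c j := \sum_(i | 0 < a i) w i * A i j.
have cpos j : 0 < a j -> 0 < c j.
  move=> aj; have := wA j; rewrite (bigID (fun i => 0 < a i)) /= -/(c j).
  (* Row [l] is among these rows and makes the sum strictly negative. *)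
  suff : \sum_(i | ~~ (0 < a i)) w i * A i j < 0 by lra.
  rewrite (bigD1 l) /=; last by rewrite -leNgt.
  have jl : l != j by apply: contraTneq aj => <-; rewrite -leNgt.
  rewrite -[ltRHS]addr0 ltr_leD//; first by rewrite pmulr_rlt0// Aneg.
  apply: sumr_le0 => i /andP[ai _].
  have ij : i != j by apply: contraNneq ai => ->.
  by rewrite ltW// pmulr_rlt0// Aneg.
have cneg j : a j <= 0 -> c j <= 0.
  move=> aj; apply: sumr_le0 => i ai.
  have ij : i != j by apply: contraTneq ai => ->; rewrite -leNgt.
  by rewrite ltW// pmulr_rlt0// Aneg.
have : \sum_j a j * c j = 0.
  under eq_bigr do rewrite mulr_sumr.
  rewrite exchange_big big1//= => i _.
  under eq_bigr do rewrite mulrCA.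
  by rewrite -mulr_sumr Aa mulr0.
apply/eqP; rewrite gt_eqF// (bigD1 k)//= ltr_pwDl ?mulr_gt0 ?cpos//.
apply: sumr_ge0 => j _; have [aj|aj] := ltP 0 (a j).
  by rewrite ltW// mulr_gt0// cpos.
by rewrite mulr_le0// cneg.
Qed.

(** A positive entry of [a] or of its opposite would make all entries of that vector positive,
    against the zero sum. *)
Lemma kernel_neg_offdiag_eq0 (n : nat) (A : 'I_n -> 'I_n -> R)
    (w a : 'I_n -> R) :
  (forall i j, i != j -> A i j < 0) -> (forall i, 0 < w i) ->
  (forall j, \sum_i w i * A i j = 0) -> (forall i, \sum_j a j * A i j = 0) ->
  \sum_j a j = 0 -> forall j, a j = 0.
Proof.
move=> Aneg w0 wA Aa a_sum0.
have npos b : (forall i, \sum_j b j * A i j = 0) -> \sum_j b j = 0 ->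
    forall k, b k <= 0.
  move=> Ab b0 k; rewrite leNgt; apply/negP => bk.
  have bpos := kernel_neg_offdiag_gt0 Aneg w0 wA Ab (ex_intro _ k bk).
  move/eqP: b0; rewrite psumr_eq0 => [|i _]; last exact: ltW.
  by move=> /allP/(_ k (mem_index_enum _))/eqP bk0; rewrite bk0 ltxx in bk.
move=> j; apply/eqP; rewrite eq_le npos//= -oppr_le0.
apply: (npos (fun j => - a j)) => [i|].
  by under eq_bigr do rewrite mulNr; rewrite sumrN Aa oppr0.
by rewrite sumrN a_sum0 oppr0.
Qed.

Lemma linear_dependence (d : nat) (v : 'I_d.+1 -> 'rV[R]_d) :
  exists2 c : 'I_d.+1 -> R, \sum_j c j *: v j = 0 & exists k, c k != 0.
Proof.
pose M := \matrix_i v i.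
have : kermx M != 0.
  by rewrite -mxrank_eq0 mxrank_ker subn_eq0 -ltnNge ltnS rank_leq_col.
move=> /rowV0Pn[u /sub_kermxP uM u0]; exists (fun j => u 0 j).
  rewrite -[RHS]uM mulmx_sum_row; apply: eq_bigr => j _.
  by rewrite rowK.
apply/existsP; apply: contra_neqT u0 => /existsPn u0.
by apply/rowP => k; rewrite mxE; have := u0 k; rewrite negbK => /eqP.
Qed.

End SignPattern.

(** * Affine position of the points [p j] relative to the vectors [g i] *)

Section PositiveDependence.
Context {R : realType} {d : nat}.
Variables (x : 'rV[R]_d) (p g : 'I_d.+1 -> 'rV[R]_d) (w : 'I_d.+1 -> R).
Hypothesis gp_lt0 : forall i j, i != j -> dot (g i) (p j - x) < 0.
Hypothesis w_gt0 : forall i, 0 < w i.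
Hypothesis wg0 : \sum_i w i *: g i = 0.

Let w_dot0 j : \sum_i w i * dot (g i) (p j - x) = 0.
Proof.
by under eq_bigr do rewrite -dotZl; rewrite -dot_suml wg0 dot0l.
Qed.

(** As the coefficients sum to zero, [p j] may be replaced by [p j - x], which puts [a] in the
    kernel of the matrix with entries [dot (g i) (p j - x)]. *)
Lemma affine_coef_eq0 (a : 'I_d.+1 -> R) :
  \sum_j a j = 0 -> (forall i, dot (g i) (\sum_j a j *: p j) = 0) ->
  forall j, a j = 0.
Proof.
move=> a0 ga; apply: (kernel_neg_offdiag_eq0 gp_lt0 w_gt0 w_dot0 _ a0) => i.
under eq_bigr do rewrite dotBr mulrBr.
by rewrite sumrB -mulr_suml a0 mul0r subr0 -[RHS](ga i) dot_sumr;
  under [RHS]eq_bigr do rewrite dotZr.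
Qed.

Lemma critical_affinely_independent : affinely_independent p.
Proof. by move=> a a0 ap0; apply: affine_coef_eq0 => // i; rewrite ap0 dot0r. Qed.

(** Replacing [x] by [y] leaves the matrix unchanged, so a linear dependence among the [d.+1]
    vectors [p j - y] lies in its kernel. It has one strict sign and normalises to barycentric
    coordinates. *)
Lemma critical_barycentric y : (forall i, dot (g i) (y - x) = 0) ->
  exists a : 'I_d.+1 -> R,
    [/\ forall j, 0 < a j, \sum_j a j = 1 & y = \sum_j a j *: p j].
Proof.
move=> gy.
have gpy i j : dot (g i) (p j - y) = dot (g i) (p j - x).
  by have := gy i; rewrite !dotBr; lra.
have [c c0 [k ck]] := linear_dependence (fun j => p j - y).
wlog {ck} ck : c c0 / 0 < c k.
  move=> wlg; have [ck0|ck0|ck0] := ltgtP (c k) 0; last 1 first.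
  - by rewrite ck0 eqxx in ck.
  - apply: (wlg (fun j => - c j)); last by rewrite oppr_gt0.
    by under eq_bigr do rewrite scaleNr; rewrite sumrN c0 oppr0.
  - exact: (wlg c).
have cker i : \sum_j c j * dot (g i) (p j - x) = 0.
  under eq_bigr do rewrite -gpy -dotZr.
  by rewrite -dot_sumr c0 dot0r.
have c_gt0 := kernel_neg_offdiag_gt0 gp_lt0 w_gt0 w_dot0 cker (ex_intro _ k ck).
set s := \sum_j c j.
have s0 : 0 < s.
  by rewrite /s (bigD1 k)//= ltr_pwDl//; apply: sumr_ge0 => j _; exact: ltW.
exists (fun j => c j / s); split=> [j||].
- exact: divr_gt0.
- by rewrite -mulr_suml divff// gt_eqF.
- move: c0; under eq_bigr do rewrite scalerBr.
  rewrite sumrB -scaler_suml -/s => /eqP; rewrite subr_eq0 => /eqP cs.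
  under eq_bigr do rewrite mulrC -scalerA.
  by rewrite -scaler_sumr cs scalerA mulVf ?scale1r// gt_eqF.
Qed.

(** Both points are affine combinations of the [p j]; their difference is orthogonal to every [g i],
    so the coefficients agree. *)
Lemma critical_orth_eq y : (forall i, dot (g i) (y - x) = 0) -> y = x.
Proof.
move=> gy.
have [a [_ a1 yE]] := critical_barycentric gy.
have [b [_ b1 xE]] : exists b : 'I_d.+1 -> R,
    [/\ forall j, 0 < b j, \sum_j b j = 1 & x = \sum_j b j *: p j].
  by apply: critical_barycentric => i; rewrite subrr dot0r.
have abE : \sum_j (a j - b j) *: p j = y - x.
  by under eq_bigr do rewrite scalerBl; rewrite sumrB -yE -xE.
have ab j : a j - b j = 0.
  by apply: (affine_coef_eq0 (a := fun j => a j - b j)) => [|i]; rewrite ?sumrB ?a1 ?b1 ?subrr// abE.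
by apply/eqP; rewrite -subr_eq0 -abE big1// => j _; rewrite ab scale0r.
Qed.

End PositiveDependence.

(** * Convex hulls of finitely many points *)

Definition simplex (R : realType) (d k : nat) (v : 'I_k -> 'rV[R]_d) :=
  [set y | exists a : 'I_k -> R,
    [/\ forall j, 0 <= a j, \sum_j a j = 1 & y = \sum_j a j *: v j]].

Lemma simplex_vertex (R : realType) (d k : nat) (v : 'I_k -> 'rV[R]_d) i :
  simplex v (v i).
Proof.
exists (fun j => (j == i)%:R); split=> [j||].
- exact: ler0n.
- by rewrite (bigD1 i)//= eqxx big1 ?addr0// => j /negPf->.
- rewrite (bigD1 i)//= eqxx scale1r big1 ?addr0// => j /negPf->.
  by rewrite mulr0n scale0r.
Qed.

Lemma simplex_convex (R : realType) (d k : nat) (v : 'I_k -> 'rV[R]_d) :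
  convex_set (simplex v).
Proof.
apply/convex_setP => _ _ t t0 t1 [a [a0 a1 ->]] [b [b0 b1 ->]].
exists (fun j => t * a j + (1 - t) * b j); split=> [j||].
- by apply: addr_ge0; apply: mulr_ge0; rewrite ?subr_ge0.
- by rewrite big_split/= -!mulr_sumr a1 b1; ring.
- rewrite !scaler_sumr -big_split/=; apply: eq_bigr => j _.
  by rewrite !scalerA [RHS]scalerDl.
Qed.

Lemma simplex_sub (R : realType) (d k : nat) (v : 'I_k -> 'rV[R]_d) A :
  convex_set A -> (forall i, A (v i)) -> simplex v `<=` A.
Proof. by move=> cA Av _ [a [a0 a1 ->]]; exact: convex_sum. Qed.

Lemma convex_hull_convex (R : realType) (d : nat) (A : set 'rV[R]_d) :
  convex_set (convex_hull A).
Proof.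
apply/convex_setP => x y t t0 t1 Ax Ay B [cB AB].
by apply: ((convex_setP B).1 cB) => //; [exact: Ax|exact: Ay].
Qed.

Lemma convex_hull_range (R : realType) (d k : nat) (v : 'I_k -> 'rV[R]_d) :
  convex_hull (range v) = simplex v.
Proof.
apply/seteqP; split=> [y|y sy B [cB vB]].
  apply; split; first exact: simplex_convex.
  by move=> _ [i _ <-]; exact: simplex_vertex.
by apply: simplex_sub sy => // i; apply: vB; exists i.
Qed.

(** * Barycentric coordinates *)

Section Barycentric.
Context {R : realType} {d : nat}.
Variable v : 'I_d.+1 -> 'rV[R]_d.
Hypothesis v_ind : affinely_independent v.

(** Homogeneous coordinates: the leading 1 turns affine independence of the [v j] into invertibility
    of [V]. *)
Let V : 'M[R]_(1 + d) := \matrix_j row_mx 1 (v j).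

Let V_mul (a : 'rV[R]_(1 + d)) :
  a *m V = row_mx (\sum_j a 0 j)%:M (\sum_j a 0 j *: v j).
Proof.
rewrite mulmx_sum_row; under eq_bigr do rewrite rowK scale_row_mx.
have -> : (\sum_j a 0 j)%:M = \sum_j a 0 j *: (1 : 'M[R]_1).
  by rewrite -scaler_suml scalemx1.
by elim/big_rec3: _ => [|j y1 y2 y3 _ ->]; rewrite ?row_mx0 ?add_row_mx.
Qed.

Let V_unit : V \in unitmx.
Proof.
rewrite -row_free_unit -kermx_eq0; apply/eqP/row_matrixP => i.
rewrite row0; move: (row i _) (row_sub i (kermx V)) => u /sub_kermxP uV.
have /eq_row_mx[s0 c0] : row_mx (\sum_j u 0 j)%:M (\sum_j u 0 j *: v j) =
    row_mx 0 0 by rewrite -V_mul uV row_mx0.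
apply/rowP => j; rewrite mxE; apply: (@v_ind (fun j => u 0 j)) => //.
by have /matrixP/(_ 0 0) := s0; rewrite !mxE eqxx mulr1n.
Qed.

(* Meaningful only for affinely independent [v], since [invmx V] is [V] itself
   when [V] is singular. *)
Definition bary (y : 'rV[R]_d) (j : 'I_d.+1) : R :=
  (row_mx 1 y *m invmx V) 0 j.

Lemma bary_spec y : \sum_j bary y j = 1 /\ \sum_j bary y j *: v j = y.
Proof.
have := V_mul (row_mx 1 y *m invmx V).
rewrite mulmxKV// => /eq_row_mx[/esym s1 /esym yE]; split=> //.
by have /matrixP/(_ 0 0) := s1; rewrite !mxE eqxx !mulr1n.
Qed.

Lemma bary_comb (a : 'I_d.+1 -> R) :
  \sum_j a j = 1 -> forall j, bary (\sum_j a j *: v j) j = a j.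
Proof.
move=> a1 j; have [b1 bE] := bary_spec (\sum_j a j *: v j).
apply/eqP; rewrite -subr_eq0; apply/eqP.
apply: (@v_ind (fun j => bary _ j - a j)).
  by rewrite sumrB b1 a1 subrr.
by under eq_bigr do rewrite scalerBl; rewrite sumrB bE subrr.
Qed.

Lemma simplexE : simplex v = [set y | forall j, 0 <= bary y j].
Proof.
apply/seteqP; split=> [_ [a [a0 a1 ->]] j|y y0]; first by rewrite bary_comb.
by have [? ?] := bary_spec y; exists (bary y).
Qed.

Lemma bary_continuous j : continuous (bary ^~ j).
Proof.
(* The coordinate is affine in [y]: the top row of the inverse gives the constant, the other rows
   the linear part. *)
pose c := usubmx (invmx V) 0 j.
pose u : 'rV[R]_d := (col j (dsubmx (invmx V)))^T.
have -> : bary ^~ j = (fun y => dot y u - - c).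
  apply/funext => y; rewrite /bary -[invmx V]vsubmxK mul_row_col mxE.
  rewrite mul1mx opprK addrC; congr (_ + _).
  by rewrite mxE; apply: eq_bigr => k _; rewrite !mxE.
apply: continuous_sub; last exact: cst_continuous.
by apply: continuous_dot => y; [exact: cvg_id|exact: cst_continuous].
Qed.

Lemma closed_simplex : closed (simplex v).
Proof.
rewrite simplexE.
have -> : [set y | forall j, 0 <= bary y j] =
    \bigcap_j [set y | 0 <= bary y j].
  by apply/seteqP; split=> y y0 j => [_|]; exact: y0.
apply: closed_bigI => j _.
apply: (@closed_comp _ _ (bary ^~ j) [set t | 0 <= t]); last exact: closed_ge.
by move=> y _; exact: bary_continuous.
Qed.

Lemma open_bary_gt0 : open [set y | forall j, 0 < bary y j].
Proof.
rewrite -[X in open X]setCK; apply: closed_openC.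
have -> : ~` [set y | forall j, 0 < bary y j] =
    \bigcup_j [set y | bary y j <= 0].
  apply/seteqP; split=> [y /existsNP[j /negP]|y [j _ /=] yj /(_ j)].
    by rewrite -leNgt => ?; exists j.
  by rewrite ltNge yj.
apply: closed_bigcup => [|j _]; first exact: finite_finset.
apply: (@closed_comp _ _ (bary ^~ j) [set t | t <= 0]); last exact: closed_le.
by move=> y _; exact: bary_continuous.
Qed.

End Barycentric.

(** * Connected sets and separations *)

Section Connectedness.
Context {T : topologicalType}.
Implicit Types C U V : set T.

Lemma connected_sub_open C U V : connected C -> open U -> open V ->
  U `&` V = set0 -> C `<=` U `|` V -> C `&` U !=set0 -> C `<=` U.
Proof.
move=> cC oU oV UV CUV CU.
suff <- : C `&` U = C by exact: subIsetr.
apply: cC => //; first by exists U.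
exists (~` V); first exact: open_closedC.
apply/seteqP; split=> y [Cy]; last by case: (CUV _ Cy).
by move=> Uy; split=> // Vy; have : (U `&` V) y by []; rewrite UV.
Qed.

Lemma connected_sub_closed C U V : connected C -> closed U -> closed V ->
  U `&` V = set0 -> C `<=` U `|` V -> C `&` U !=set0 -> C `<=` U.
Proof.
move=> cC oU oV UV CUV CU.
suff <- : C `&` U = C by exact: subIsetr.
apply: cC => //; last by exists U.
exists (~` V); first exact: closed_openC.
apply/seteqP; split=> y [Cy]; last by case: (CUV _ Cy).
by move=> Uy; split=> // Vy; have : (U `&` V) y by []; rewrite UV.
Qed.

End Connectedness.

(** * Convexity, components and closures in the space of row vectors *)

Section RowVectorTopology.
Context {R : realType} {d : nat}.
Implicit Types (A : set 'rV[R]_d) (x y : 'rV[R]_d).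

Lemma convex_connected A : convex_set A -> connected A.
Proof.
move=> /convex_setP cA.
have [->|/set0P[x Ax]] := eqVneq A set0; first exact: connected0.
pose seg y := (fun t : R => t *: y - (t - 1) *: x) @` `[0, 1].
have segA y : A y -> seg y `<=` A.
  move=> Ay z [t /=]; rewrite in_itv/= => /andP[t0 t1] <-.
  by rewrite -scaleNr opprB; exact: cA.
have -> : A = \bigcup_(y in A) seg y.
  apply/seteqP; split=> [y Ay|z [y Ay]]; last exact: segA.
  exists y => //; exists 1; first by rewrite /= in_itv/= ler01 lexx.
  by rewrite subrr scale0r subr0 scale1r.
apply: bigcup_connected => [|y Ay].
  exists x => y Ay; exists 0; first by rewrite /= in_itv/= ler01 lexx.
  by rewrite scale0r !sub0r scaleN1r opprK.
apply: connected_continuous_connected; first exact: segment_connected.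
apply: continuous_subspaceT; apply: continuous_sub => t.
  by apply: (@cvgZr_tmp _ 'rV[R]_d); exact: cvg_id.
apply: (@cvgZr_tmp _ 'rV[R]_d); apply: cvgB; first exact: cvg_id.
exact: cst_continuous.
Qed.

Let convex_lt (t a b e : R) : 0 <= t -> t <= 1 -> a < e -> b < e ->
  t * a + (1 - t) * b < e.
Proof.
move=> t0 t1 ae be; have [->|tn0] := eqVneq t 0.
  by rewrite mul0r add0r subr0 mul1r.
have : t * a < t * e by rewrite ltr_pM2l// lt0r tn0.
have : (1 - t) * b <= (1 - t) * e by rewrite ler_wpM2l ?subr_ge0// ltW.
lra.
Qed.

Lemma ball_convex x (e : R) : convex_set (ball x e).
Proof.
apply/convex_setP => y z t t0 t1; rewrite -!ball_normE /= => xy xz.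
have -> : x - (t *: y + (1 - t) *: z) = t *: (x - y) + (1 - t) *: (x - z).
  by apply/rowP => k; rewrite !mxE; ring.
rewrite (le_lt_trans (ler_normD _ _))// !normrZ !ger0_norm ?subr_ge0//.
exact: convex_lt.
Qed.

(** A ball inside [A] is connected, so a component that meets it contains it. This yields that
    components are both open and closed relative to [A]. *)
Lemma open_component_ball A x y : open A -> A y ->
  exists2 e : R, 0 < e & forall z, ball y e z ->
    connected_component A x z -> ball y e `<=` connected_component A x.
Proof.
move=> oA Ay; have [e e0 yeA] : exists2 e : R, 0 < e & ball y e `<=` A.
  by have /nbhs_ballP[e e0 yeA] : nbhs y A; [exact: open_nbhs_nbhs|exists e].
exists e => // z yz xz; rewrite (same_connected_component xz).
by apply: connected_component_max => //; exact/convex_connected/ball_convex.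
Qed.

Lemma component_open A x : open A -> open (connected_component A x).
Proof.
move=> oA; rewrite openE => y Dy.
have [e e0 /(_ y)] := open_component_ball x oA (connected_component_sub Dy).
move=> /(_ (ballxx _ e0) Dy) yeD.
by apply/nbhs_ballP; exists e.
Qed.

Lemma closure_component A x y : open A -> A y ->
  closure (connected_component A x) y -> connected_component A x y.
Proof.
move=> oA Ay cDy; have [e e0 De] := open_component_ball x oA Ay.
have [z [Dz yz]] := cDy _ (nbhsx_ballx _ _ e0).
exact: De Dz _ (ballxx _ e0).
Qed.

Lemma closure_convex A : convex_set A -> convex_set (closure A).
Proof.
move=> /convex_setP cA; apply/convex_setP => x y t t0 t1 clx cly.
move=> B /nbhs_ballP[e /= e0 eB].
have e20 : 0 < e / 2 by rewrite divr_gt0.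
have [x' [Ax' xx']] := clx _ (nbhsx_ballx _ _ e20).
have [y' [Ay' yy']] := cly _ (nbhsx_ballx _ _ e20).
exists (t *: x' + (1 - t) *: y'); split; first exact: cA.
apply: eB; move: xx' yy'; rewrite -!ball_normE /= => xx' yy'.
have -> : t *: x + (1 - t) *: y - (t *: x' + (1 - t) *: y') =
    t *: (x - x') + (1 - t) *: (y - y').
  by apply/rowP => k; rewrite !mxE; ring.
rewrite (le_lt_trans (ler_normD _ _))// !normrZ !ger0_norm ?subr_ge0//.
rewrite (lt_trans (convex_lt t0 t1 xx' yy'))//; lra.
Qed.

End RowVectorTopology.

Lemma exists_neq_ord (n : nat) (i : 'I_n.+1) :
  (0 < n)%N -> exists j : 'I_n.+1, i != j.
Proof.
move=> n0; have [->|i0] := eqVneq i ord0; last by exists ord0.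
by exists ord_max; rewrite -val_eqE/= eq_sym -lt0n.
Qed.

(** * Equilibria of a critical family *)

Section CriticalFamily.
Context {R : realType} {d : nat}.
Variable C : 'I_d.+1 -> set 'rV[R]_d.
Hypotheses (d_gt0 : (1 <= d)%N) (critC : critical_family C).
Implicit Types (x y z : 'rV[R]_d) (w : 'I_d.+1 -> R).

Let cptC i : compact (C i). Proof. by case: critC. Qed.
Let cvxC i : convex_set (C i). Proof. by case: critC. Qed.

Local Notation K j := (\bigcap_(i in [set i | i != j]) C i).

Let K0 j : K j !=set0. Proof. by case: critC. Qed.

Let C0 i : C i !=set0.
Proof.
have [j ij] := exists_neq_ord i d_gt0.
by have [q Kq] := K0 j; exists q; exact: Kq.
Qed.

Local Notation g i := (gap (C i)).

Let g_eq0 i x : g i x = 0 <-> C i x.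
Proof. exact: gap_eq0. Qed.

Let g_continuous i : continuous (g i).
Proof. exact: gap_continuous. Qed.

Local Notation U := (~` \bigcup_i C i).

Lemma critical_open_compl : open U.
Proof.
apply: closed_openC; apply: closed_bigcup => [|i _]; first exact: finite_finset.
by apply: compact_closed => //; exact: norm_hausdorff.
Qed.

(** Up to a factor 2, the vanishing at [x] of the gradient of the weighted sum of squared distances
    to the [C i]. *)
Definition equilibrium w x := \sum_i w i *: gap (C i) x = 0.

Let equilibrium_sum w x q : equilibrium w x ->
  \sum_i w i * dot (g i x) (q - x) = 0.
Proof.
by move=> wx; under eq_bigr do rewrite -dotZl; rewrite -dot_suml wx dot0l.
Qed.

Lemma equilibrium_out w x : (forall i, 0 < w i) -> equilibrium w x -> U x.
Proof.
move=> w0 wx [k _ Ckx].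
have [q Kq] := K0 k.
(* The point [q] may lie outside [C k], but the gap at [k] vanishes. *)
have le_g i : w i * dot (g i x) (q - x) <= - (w i * dot (g i x) (g i x)).
  rewrite -mulrN ler_pM2l//; have [->|ik] := eqVneq i k.
    by rewrite ((g_eq0 _ _).2 Ckx) !dot0l oppr0.
  by apply: dot_gap_le => //; exact: Kq.
have : \sum_i w i * dot (g i x) (g i x) <= 0.
  rewrite -oppr_ge0 -sumrN; apply: le_trans (ler_sum _ (fun i _ => le_g i)).
  by rewrite equilibrium_sum.
have wg_ge0 i : 0 <= w i * dot (g i x) (g i x).
  by rewrite mulr_ge0 ?dot_ge0// ltW.
move=> s0; have : \bigcap_i C i = set0 by case: critC.
apply/eqP/set0P; exists x => i _; apply/g_eq0/dot_eq0.
have /eqP : \sum_i w i * dot (g i x) (g i x) = 0.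
  by apply/eqP; rewrite eq_le s0 sumr_ge0.
rewrite psumr_eq0// => /allP/(_ i (mem_index_enum _))/=.
by rewrite mulf_eq0 gt_eqF//= => /eqP.
Qed.

Lemma equilibrium_dot_lt0 w x q i j : (forall i, 0 < w i) ->
  equilibrium w x -> K j q -> i != j -> dot (g i x) (q - x) < 0.
Proof.
move=> w0 wx Kq ij.
have /le_lt_trans : dot (g i x) (q - x) <= - dot (g i x) (g i x).
  by apply: dot_gap_le => //; exact: Kq.
apply; rewrite oppr_lt0 dot_gt0//; apply/eqP => /g_eq0 Cix.
by apply: (equilibrium_out w0 wx); exists i.
Qed.

(** Firm nonexpansiveness, summed with the weights, forces equal gaps at [x] and [y]; then [y - x]
    is orthogonal to every gap. *)
Lemma equilibrium_unique w x y : (forall i, 0 < w i) ->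
  equilibrium w x -> equilibrium w y -> x = y.
Proof.
move=> w0 wx wy.
have [p Kp] := choice K0.
have gxy i : g i x = g i y.
  apply/eqP; rewrite -subr_eq0; apply/eqP/dot_eq0.
  have dist_ge0 k : 0 <= w k * dot (g k x - g k y) (g k x - g k y).
    by rewrite mulr_ge0 ?dot_ge0// ltW.
  have /eqP : \sum_k w k * dot (g k x - g k y) (g k x - g k y) = 0.
    apply/eqP; rewrite eq_le sumr_ge0// andbT.
    apply: (@le_trans _ _ (\sum_k w k * dot (g k x - g k y) (x - y))).
      by apply: ler_sum => k _; rewrite ler_pM2l//; exact: gap_firm.
    under eq_bigr do rewrite -dotZl scalerBr.
    by rewrite -dot_suml sumrB wx wy subrr dot0l.
  rewrite psumr_eq0// => /allP/(_ i (mem_index_enum _))/=.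
  by rewrite mulf_eq0 gt_eqF//= => /eqP.
apply/esym/(@critical_orth_eq _ _ x p (fun i => g i x) w) => // [i j|i].
  exact: equilibrium_dot_lt0.
by apply: gap_eq_orth => //; exact: gxy.
Qed.

(** The interior and the exterior of the simplex are disjoint open sets covering the complement [U],
    and [x] lies in the interior. *)
Lemma equilibrium_component_sub w x (p : 'I_d.+1 -> 'rV[R]_d) :
  (forall i, 0 < w i) -> equilibrium w x -> (forall j, K j (p j)) ->
  affinely_independent p /\ connected_component U x `<=` simplex p.
Proof.
move=> w0 wx Kp.
have gp i j : i != j -> dot (g i x) (p j - x) < 0.
  exact: equilibrium_dot_lt0.
have p_ind := critical_affinely_independent gp w0 wx.
split=> //.
have pos_sub : [set y | forall j, 0 < bary p y j] `<=` simplex p.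
  by rewrite simplexE// => y y0 j; exact/ltW/y0.
apply: (subset_trans _ pos_sub).
apply: (@connected_sub_open _ _ _ (~` simplex p)).
- exact: component_connected.
- exact: open_bary_gt0.
- exact/closed_openC/closed_simplex.
- by apply/disjoints_subset; rewrite setCK.
- move=> y /connected_component_sub Uy.
  have [sy|] := pselect (simplex p y); [left=> j|by right].
  move: sy; rewrite simplexE// => sy; rewrite lt0r sy andbT.
  (* A point whose coordinate [j] is zero is a convex combination of the [p i] with [i != j], all of
     which lie in [C j]. *)
  apply/eqP => yj; apply: Uy; exists j => //.
  have [b1 <-] := bary_spec p_ind y.
  apply: convex_sum => // i yi; apply: Kp => /=.
  by apply: contra_neq yi => <-.
- exists x; split.
    exact/connected_component_refl/(equilibrium_out w0 wx).
  have gx0 i : dot (g i x) (x - x) = 0 by rewrite subrr dot0r.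
  have [a [a0 a1 xE]] := critical_barycentric gp w0 wx gx0.
  by move=> j /=; rewrite xE bary_comb.
Qed.


Lemma bounding_ball : exists2 M : R, 0 <= M &
  forall i, C i `<=` [set y | `|y| <= M].
Proof.
have /choice[m mC] : forall i, exists m : R, 0 < m /\ forall y, C i y -> `|y| < m.
  move=> i; have /ex_strict_bound_gt0[m m0 mC] := compact_bounded (@cptC i).
  by exists m.
exists (\sum_i m i) => [|i y Ciy /=].
  by apply: sumr_ge0 => i _; rewrite ltW//; case: (mC i).
apply: le_trans (ltW ((mC i).2 _ Ciy)) _.
by rewrite (bigD1 i)//= lerDl; apply: sumr_ge0 => k _; rewrite ltW//; case: (mC k).
Qed.

(** * Existence and continuation of equilibria in a bounding ball *)

Section Box.
Variable M : R.
Hypothesis M_ge0 : 0 <= M.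
Hypothesis CM : forall i, C i `<=` [set y | `|y| <= M].
Local Notation B := [set y : 'rV[R]_d | `|y| <= M].

Lemma bounded_norm_le : bounded_set B.
Proof.
exists M; split; first exact: num_real.
by move=> t Mt y /= yM; rewrite (le_trans yM)// ltW.
Qed.

Lemma convex_norm_le : convex_set B.
Proof.
apply/convex_setP => x y t t0 t1 /= xM yM.
rewrite (le_trans (ler_normD _ _))// !normrZ !ger0_norm ?subr_ge0//.
have : t * `|x| <= t * M by rewrite ler_wpM2l.
have : (1 - t) * `|y| <= (1 - t) * M by rewrite ler_wpM2l ?subr_ge0.
lra.
Qed.

Lemma compact_norm_le : compact B.
Proof.
apply: bounded_closed_compact; first exact: bounded_norm_le.
apply: (@closed_comp _ _ (fun y : 'rV[R]_d => `|y|) [set t | t <= M]).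
  by move=> y _; exact: norm_continuous.
exact: closed_le.
Qed.

Lemma equilibrium_exists w : (forall i, 0 < w i) ->
  exists2 x, B x & equilibrium w x.
Proof.
move=> w0; pose Phi y := \sum_i w i * dot (g i y) (g i y).
have cPhi : continuous Phi.
  apply: continuous_big => [|i _]; first exact: add_continuous.
  apply: continuous_mull; exact: (continuous_dot (@g_continuous i) (@g_continuous i)).
have B0 : B !=set0 by exists 0; rewrite /= normr0.
have [x /set_mem Bx xmin] := EVT_min_rV B0 compact_norm_le
  (continuous_subspaceT cPhi).
exists x => //.
pose W := \sum_i w i.
have W0 : 0 < W.
  by rewrite /W (bigD1 ord0)//= ltr_pwDl//; apply: sumr_ge0 => j _; exact: ltW.
pose G := \sum_i w i *: g i x.
(* The weighted mean [y] of the projections of [x] has a smaller [Phi] unless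
   [G = 0]; this replaces differentiating [Phi]. *)
pose y := x - W^-1 *: G.
have yE : y = \sum_i (w i / W) *: proj (C i) x.
  have -> : y = \sum_i (w i / W) *: x - \sum_i (w i / W) *: g i x.
    rewrite -scaler_suml -mulr_suml divff ?gt_eqF// scale1r; congr (_ - _).
    by rewrite scaler_sumr; apply: eq_bigr => i _; rewrite scalerA mulrC.
  rewrite -sumrB; apply: eq_bigr => i _.
  by rewrite -scalerBr subKr.
(* [x] minimises over [B] only, so the competitor has to lie in [B]. *)
have By : B y.
  rewrite yE; apply: convex_sum => [|i||i _].
  - exact: convex_norm_le.
  - by rewrite divr_ge0// ltW.
  - by rewrite -mulr_suml divff// gt_eqF.
  - by apply: (CM (i := i)); exact: proj_in.
have : Phi y <= Phi x - W^-1 * dot G G.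
  (* The projections of [x] serve as competitors for those of [y]; the resulting sum is exactly
     [Phi x - W^-1 * dot G G]. *)
  apply: (@le_trans _ _ (\sum_i w i * dot (y - proj (C i) x) (y - proj (C i) x))).
    apply: ler_sum => i _; rewrite ler_pM2l//.
    exact: (proj_nearest (@cptC i) (@C0 i) y).2 _ (proj_in (@cptC i) (@C0 i) x).
  have -> : \sum_i w i * dot (y - proj (C i) x) (y - proj (C i) x) =
      \sum_i (w i * dot (g i x) (g i x) - 2 / W * dot (w i *: g i x) G
        + w i * (W^-1 ^+ 2 * dot G G)).
    apply: eq_bigr => i _; rewrite /y addrAC -/(g i x).
    move: (g i x) => u.
    rewrite dotBl !dotBr !dotZl !dotZr (dotC G u); ring.
  rewrite big_split sumrB/= -mulr_suml -/W -mulr_sumr -dot_suml -/G -/(Phi x).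
  rewrite mulrA (_ : W * W^-1 ^+ 2 = W^-1); last first.
    by rewrite expr2 mulrA divff ?mul1r// gt_eqF.
  lra.
have /(xmin y) : y \in B by exact/mem_set.
move=> /le_trans/[apply]; rewrite lerDl oppr_ge0 pmulr_rle0 ?invr_gt0// => G0.
by apply: dot_eq0; apply/eqP; rewrite eq_le G0 dot_ge0.
Qed.


Let wt (j : 'I_d.+1) (t : R) (i : 'I_d.+1) := if i == j then t else 1.

Let wt_gt0 j t i : 0 < t -> 0 < wt j t i.
Proof. by rewrite /wt; case: eqP. Qed.

(** The parameter is kept as a component, so that sets of parameters are continuous images of
    compact sets. *)
Let compact_equilibria j e : compact
  [set q : R * 'rV[R]_d | [/\ `[e, 1]%classic q.1, B q.2 & equilibrium (wt j q.1) q.2]].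
Proof.
pose S (q : R * 'rV[R]_d) := \sum_i wt j q.1 i *: g i q.2.
have cS : continuous S.
  apply: continuous_big => [|i _]; first exact: add_continuous.
  apply: continuous_scale.
    rewrite /wt; case: eqP => _ q; last exact: cst_continuous.
    exact: cvg_fst.
  move=> q; apply: (@continuous_comp _ _ _ snd (g i)); first exact: cvg_snd.
  exact: g_continuous.
have -> : [set q : R * 'rV[R]_d |
    [/\ `[e, 1]%classic q.1, B q.2 & equilibrium (wt j q.1) q.2]] =
    (`[e, 1] `*` B) `&` [set r | dot (S r) (S r) = 0].
  apply/seteqP; split=> [q [eq Bq Sq]|q [[eq Bq] /dot_eq0 Sq]]; last by split.
  by split=> //=; rewrite /S Sq dot0l.
apply: compact_closedI.
  by apply: compact_setX; [exact: segment_compact|exact: compact_norm_le].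
have cSS : continuous (fun r => dot (S r) (S r)) by exact: continuous_dot.
apply: ((continuous_closedP _).1 cSS [set t | t = 0]); exact: closed_eq.
Qed.

(** Continuation in the weight of [C j] from 1 down to [e], which stays positive so that equilibria
    are unique and avoid every [C i]. *)
Lemma equilibrium_in_component j x (e : R) : equilibrium (fun=> 1) x -> B x ->
  0 < e -> e <= 1 ->
  exists y, [/\ B y, connected_component U x y & equilibrium (wt j e) y].
Proof.
move=> wx Bx e0 e1.
pose D := connected_component U x.
pose G := [set q : R * 'rV[R]_d |
  [/\ `[e, 1]%classic q.1, B q.2 & equilibrium (wt j q.1) q.2]].
have G_gt0 q : G q -> 0 < q.1.
  by move=> [/=]; rewrite in_itv/= => /andP[eq _] _ _; exact: lt_le_trans eq.
have G_out q : G q -> U q.2.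
  move=> Gq; case: (Gq) => _ _; apply: equilibrium_out => i.
  exact/wt_gt0/G_gt0.
(* Used for the closure of [D] and for the complement of the open set [D]; equilibria in the closure
   of [D] are in [D] since they lie in [U]. *)
have closed_proj F : closed F -> closed (fst @` (G `&` (snd @^-1` F))).
  move=> cF; apply: compact_closed; first exact: norm_hausdorff.
  apply: continuous_compact.
    by apply: continuous_subspaceT => q; exact: cvg_fst.
  apply: compact_closedI; first exact: compact_equilibria.
  by apply: closed_comp cF => q _; exact: cvg_snd.
have wt1 : wt j 1 = fun=> 1 by apply/funext => i; rewrite /wt if_same.
have Dx : D x.
  exact/connected_component_refl/(equilibrium_out (w := fun=> 1)).
(* By uniqueness of equilibria, those in [D] and those outside [D] have disjoint
   closed sets of parameters, so connectedness of [[e, 1]] replaces continuity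
   of the equilibrium in its parameter. *)
have : `[e, 1] `<=` fst @` (G `&` (snd @^-1` closure D)).
  apply: (@connected_sub_closed _ _ _ (fst @` (G `&` (snd @^-1` (~` D))))).
  - exact: segment_connected.
  - exact/closed_proj/closed_closure.
  - exact/closed_proj/open_closedC/component_open/critical_open_compl.
  - apply/seteqP; split=> // t [[q [Gq Dq] <-] [q' [Gq' Dq'] qq']].
    apply: Dq'; have -> : q'.2 = q.2.
      case: (Gq') (Gq) => _ _; rewrite qq' => eq' [_ _ eq].
      apply: equilibrium_unique eq' eq => i; exact/wt_gt0/G_gt0.
    by apply: closure_component => //; [exact: critical_open_compl|exact: G_out].
  - move=> t et.
    have t0 : 0 < t by move: et; rewrite /= in_itv/= => /andP[/(lt_le_trans e0)].
    have [y By ey] := equilibrium_exists (fun i => wt_gt0 j i t0).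
    have [Dy|nDy] := pselect (D y); [left|right]; exists (t, y) => //.
    by split=> //; exact: subset_closure.
  - exists 1; split; first by rewrite /= in_itv/= e1 lexx.
    exists (1, x) => //; split; last exact: subset_closure.
    by split=> //=; [rewrite in_itv/= e1 lexx|rewrite wt1].
move=> /(_ e); case=> [|[t y] [Gq Dy] /= te].
  by rewrite /= in_itv/= lexx e1.
case: (Gq) => /= _ By; rewrite te => ey; exists y; split=> //.
apply: closure_component => //; first exact: critical_open_compl.
exact: (G_out _ Gq).
Qed.

(** [h] vanishes exactly on the intersection of the [C i] with [i != j]. Comparing its minimum over
    the closure of [D] with its values at equilibria avoids extracting a limit as the weight tends
    to 0. *)
Lemma closure_component_meets j x : equilibrium (fun=> 1) x -> B x ->
  connected_component U x `<=` B ->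
  exists2 z, closure (connected_component U x) z & K j z.
Proof.
move=> wx Bx DB; set D := connected_component U x.
have [q Kq] := K0 j.
pose h z := \sum_(i | i != j) dot (g i z) (g i z).
have ch : continuous h.
  apply: continuous_big => [|i _]; first exact: add_continuous.
  exact: continuous_dot.
have compD : compact (closure D).
  apply: subclosed_compact compact_norm_le _; first exact: closed_closure.
  rewrite [X in _ `<=` X](closure_id _).1; first exact: closureS.
  apply: compact_closed compact_norm_le; exact: norm_hausdorff.
have Dx : D x.
  exact/connected_component_refl/(equilibrium_out (w := fun=> 1)).
have [z /set_mem Dz zmin] := EVT_min_rV (ex_intro _ x (subset_closure Dx)) compD
  (continuous_subspaceT ch).
have cb : continuous (fun y => dot (g j y) (q - y)).
  apply: continuous_dot; first exact: g_continuous.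
  by apply: continuous_sub => y; [exact: cst_continuous|exact: cvg_id].
have [y0 _ bmax] := EVT_max_rV (ex_intro _ x Bx) compact_norm_le
  (continuous_subspaceT cb).
set b := dot (g j y0) (q - y0) in bmax.
(* Pair the equilibrium equation at [y] with [q - y]: the terms with [i != j] sum to at most
   [- h y], and the remaining one is at most [e * b]. *)
have h_le (e : R) : 0 < e -> e <= 1 -> h z <= e * b.
  move=> e0 e1; have [y [By Dy ey]] := equilibrium_in_component j wx Bx e0 e1.
  apply: le_trans (zmin y _) _; first exact/mem_set/subset_closure.
  apply: (@le_trans _ _ (e * dot (g j y) (q - y))); last first.
    by rewrite ler_pM2l//; exact/bmax/mem_set.
  have := equilibrium_sum q ey; rewrite (bigD1 j)//= {1}/wt eqxx => eqy.
  suff : h y <= - \sum_(i | i != j) wt j e i * dot (g i y) (q - y) by lra.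
  rewrite -sumrN; apply: ler_sum => i ij.
  rewrite /wt (negPf ij) mul1r lerNr.
  by apply: dot_gap_le => //; exact: Kq.
have h_ge0 : 0 <= h z by apply: sumr_ge0 => i _; exact: dot_ge0.
have h0 : h z = 0.
  apply/eqP; rewrite eq_le h_ge0 andbT leNgt; apply/negP => hz.
  (* If [h z] were positive, dividing it by this number would give an admissible [e], and the bound
     would force the number to be at most [b]. *)
  have s0 : 0 < h z + `|b| + 1 by rewrite ltr_wpDl// addr_ge0.
  have : h z <= h z / (h z + `|b| + 1) * b.
    apply: h_le; first exact: divr_gt0.
    by rewrite ler_pdivrMr// mul1r -addrA lerDl addr_ge0.
  rewrite mulrAC ler_pdivlMr// ler_pM2l// => hb.
  by have := ler_norm b; lra.
exists z => // i /= ij; apply/g_eq0/dot_eq0; apply/eqP.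
move/eqP: h0; rewrite psumr_eq0 => [/allP/(_ i (mem_index_enum _))|k _].
  by rewrite ij.
exact: dot_ge0.
Qed.

End Box.

End CriticalFamily.

Theorem theorem2p1 (R : realType) (d : nat) (C : 'I_d.+1 -> set 'rV[R]_d) :
  (1 <= d)%N ->
  critical_family C ->
  exists D : set 'rV[R]_d,
    [/\ is_component (~` \bigcup_i C i) D,
        D !=set0,
        open D,
        bounded_set D &
        is_simplex d (closure (convex_hull D))].
Proof.
move=> d_gt0 critC.
have [M M0 CM] := bounding_ball critC.
have w0 (i : 'I_d.+1) : 0 < (1 : R) by [].
have [x Bx wx] := equilibrium_exists d_gt0 critC M0 CM w0.
have Ux := equilibrium_out d_gt0 critC w0 wx.
set U := ~` \bigcup_i C i in Ux *.
pose D := connected_component U x.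
have K0 j : \bigcap_(i in [set i | i != j]) C i !=set0 by case: critC.
have KB j q : (\bigcap_(i in [set i | i != j]) C i) q -> `|q| <= M.
  have [i ji] := exists_neq_ord j d_gt0.
  by move=> Kq; apply/(CM i)/Kq; rewrite /= eq_sym.
(* Arbitrary points of the partial intersections already bound [D]; this is needed before the actual
   vertices can be found in its closure. *)
have DB : D `<=` [set y | `|y| <= M].
  have [p Kp] := choice K0.
  have [_ /subset_trans] := equilibrium_component_sub d_gt0 critC w0 wx Kp.
  apply; apply: simplex_sub => [|j]; first exact: convex_norm_le.
  exact: KB (Kp j).
have Dx : D x by exact: connected_component_refl.
have /choice[q /all_and2[Dq Kq]] : forall j, exists z,
    closure D z /\ (\bigcap_(i in [set i | i != j]) C i) z.
  move=> j.
  have [z Dz Kz] := closure_component_meets d_gt0 critC M0 CM j wx Bx DB.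
  by exists z.
(* A second use of the same containment, now with vertices in the closure of [D]. *)
have [q_ind Dsub] := equilibrium_component_sub d_gt0 critC w0 wx Kq.
exists D; split.
- by exists x.
- by exists x.
- exact/component_open/critical_open_compl.
- have [N [Nreal BN]] := @bounded_norm_le R d M.
  by exists N; split=> // t Nt y Dy; exact/(BN t Nt)/DB.
(* The simplex is closed, convex and contains [D]; conversely its vertices lie in the closure of the
   hull, which is convex. *)
- exists q => //; rewrite convex_hull_range; apply/seteqP; split.
    rewrite [X in _ `<=` X](closure_id _).1; last exact: closed_simplex.
    apply: closureS => y; apply; split=> //; exact: simplex_convex.
  apply: simplex_sub => [|j]; first exact/closure_convex/convex_hull_convex.
  by apply: closureS (Dq j) => y Dy A [_]; exact.
Qed.
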